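(* Let $X$ be a completely regular space with a replete admissible family $\mathcal{O}$ of open coverings, let $S$ be a topological semigroup acting on $X$ with every map $\mu_s:X\to X$ continuous, and let $\mathcal{F}$ be a filter basis on the subsets of $S$. If $(S,X)$ is $\mathcal{F}$-asymptotically compact, then it is $\mathcal{F}$-limit compact. Conversely, if $X$ is a complete admissible space and $(S,X)$ is $\mathcal{F}$-limit compact, then $(S,X)$ is $\mathcal{F}$-asymptotically compact.
   Context: Coverings. For coverings $\mathcal{U},\mathcal{V}$ of $X$: $\mathcal{V}\leqslant\mathcal{U}$ means $\mathcal{V}$ refines $\mathcal{U}$ (each member of $\mathcal{V}$ is contained in some member of $\mathcal{U}$); $\mathcal{V}\leqslant\frac12\mathcal{U}$ means that for all $V,V'\in\mathcal{V}$ with $V\cap V'\neq\emptyset$ there is $U\in\mathcal{U}$ with $V\cup V'\subset U$. The star of $Y\subset X$ is $\mathrm{St}[Y,\mathcal{U}]=\bigcup\{U\in\mathcal{U}:Y\cap U\neq\emptyset\}$, and $\mathrm{St}[x,\mathcal{U}]=\mathrm{St}[\{x\},\mathcal{U}]$. A family $\mathcal{O}$ of open coverings of $X$ is admissible if: (1) for each $\mathcal{U}\in\mathcal{O}$ there is $\mathcal{V}\in\mathcal{O}$ with $\mathcal{V}\leqslant\frac12\mathcal{U}$; (2) if $Y\subset X$ is open and $K\subset Y$ is compact, there is $\mathcal{U}\in\mathcal{O}$ with $\mathrm{St}[K,\mathcal{U}]\subset Y$; (3) for $\mathcal{U},\mathcal{V}\in\mathcal{O}$ there is $\mathcal{W}\in\mathcal{O}$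 with $\mathcal{W}\leqslant\mathcal{U}$ and $\mathcal{W}\leqslant\mathcal{V}$. It is replete if moreover $X=\bigcup_{\mathcal{U}\in\mathcal{O}}\mathrm{St}[x,\mathcal{U}]$ for every $x\in X$, and for $\mathcal{U},\mathcal{V}\in\mathcal{O}$ there is $\mathcal{W}\in\mathcal{O}$ with $\mathcal{U}\leqslant\frac12\mathcal{W}$ and $\mathcal{V}\leqslant\frac12\mathcal{W}$. (Completely regular spaces are not assumed Hausdorff.) A nonempty $Y\subset X$ is bounded if there is $\mathcal{U}\in\mathcal{O}$ with $y\in\mathrm{St}[x,\mathcal{U}]$ for all $x,y\in Y$. A net is bounded if its set of values is bounded. A net $(x_\lambda)$ in $X$ is Cauchy if for each $\mathcal{U}\in\mathcal{O}$ there is $\lambda_0$ such that $x_{\lambda_2}\in\mathrm{St}[x_{\lambda_1},\mathcal{U}]$ for all $\lambda_1,\lambda_2\geq\lambda_0$. $X$ is a complete admissible space if every Cauchy net in $X$ converges. Actions. An action of $S$ on $X$ is a map $\mu:S\times X\to X$, $\mu(s,x)=sx$, with $s(tx)=(st)x$; $\mu_s(x)=sx$. For $A\subset S$, $Y\subset X$, $AY=\bigcup_{s\in A}\mu_s(Y)$. A filter basis $\mathcal{F}$ on the subsets of $S$ is a nonempty family of subsets with $\emptyset\notin\mathcal{F}$ and such that for $A,B\in\mathcal{F}$ there is $C\in\mathcal{F}$ with $C\subset A\cap B$. A net $(t_\lambda)$ in $S$ satisfies $t_\lambda\to_{\mathcal{F}}\infty$ if for each $A\in\mathcal{F}$ there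 is $\lambda_0$ with $t_\lambda\in A$ for all $\lambda\geq\lambda_0$. $(S,X)$ is $\mathcal{F}$-asymptotically compact if for every bounded net $(x_\lambda)$ in $X$ and every net $(t_\lambda)$ in $S$ (same index set) with $t_\lambda\to_{\mathcal{F}}\infty$, the net $(t_\lambda x_\lambda)$ has a convergent subnet. $(S,X)$ is $\mathcal{F}$-limit compact if for every bounded set $B\subset X$ and every $\mathcal{U}\in\mathcal{O}$ there is $A\in\mathcal{F}$ such that $AB$ admits a finite cover $AB\subset\bigcup_{i=1}^n\mathrm{St}[x_i,\mathcal{U}]$ with $x_1,\dots,x_n\in X$. *)

(* Defs.v *)
From HB Require Import structures.
From mathcomp Require Import all_boot.
From mathcomp Require Import all_classical all_reals topology normedtype.

Set Implicit Arguments.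
Unset Strict Implicit.
Unset Printing Implicit Defensive.

Local Open Scope classical_set_scope.

HB.structure Definition PreTopologicalSemigroup :=
  {S of Topological S & Semigroup S}.

HB.mixin Record PreTopologicalSemigroup_isTopologicalSemigroup S
    & PreTopologicalSemigroup S := {
  mulg_continuous : continuous (fun st : S * S => (st.1 * st.2)%g)
}.

#[short(type="topologicalSemigroupType")]
HB.structure Definition TopologicalSemigroup :=
  {S of PreTopologicalSemigroup S
      & PreTopologicalSemigroup_isTopologicalSemigroup S}.

(* Directed preorders; antisymmetry is not required. *)
Record directedSet := DirectedSet {
  dset_sort :> Type;
  dle : dset_sort -> dset_sort -> Prop;
  dle_refl : forall l, dle l l;
  dle_trans : forall l2 l1 l3, dle l1 l2 -> dle l2 l3 -> dle l1 l3;
  dset_nonempty : inhabited dset_sort;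
  dset_directed : forall l1 l2, exists l3, dle l1 l3 /\ dle l2 l3
}.

Section Nets.
Implicit Types L M : directedSet.

(* The filter of sets of indices containing all l >= l0 for some l0: a net
   x : L -> X converges to p when x @ tails L --> p. *)
Definition tails L : set_system L :=
  filter_from setT (fun l0 : L => [set l | dle l0 l]).
Arguments tails : clear implicits.

Definition net_converges (X : topologicalType) L (x : L -> X) :=
  exists p : X, x @ tails L --> p.

(* x \o h is a subnet of x when h is monotone and cofinal. *)
Definition is_subnet_map M L (h : M -> L) :=
  (forall m1 m2, dle m1 m2 -> dle (h m1) (h m2)) /\
  (forall l, exists m, dle l (h m)).

Definition has_convergent_subnet (X : topologicalType) L (x : L -> X) :=
  exists (M : directedSet) (h : M -> L),
    is_subnet_map h /\ net_converges (x \o h).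

End Nets.

Section Coverings.
Context {X : topologicalType}.
Implicit Types (U V W : set (set X)) (O : set (set (set X))) (Y K : set X).

Definition open_covering U :=
  (forall A, U A -> open A) /\ cover U id = setT.

Definition refines V U := forall A, V A -> exists2 B, U B & A `<=` B.

Definition half_refines V U :=
  forall A A', V A -> V A' -> A `&` A' !=set0 ->
    exists2 B, U B & A `|` A' `<=` B.

Definition star Y U : set X :=
  \bigcup_(A in [set A | U A /\ Y `&` A !=set0]) A.

Record admissible O : Prop := Admissible {
  admissible_open : forall U, O U -> open_covering U;
  admissible_half : forall U, O U -> exists2 V, O V & half_refines V U;
  admissible_compact : forall Y K, open Y -> compact K -> K `<=` Y ->
    exists2 U, O U & star K U `<=` Y;
  admissible_directed : forall U V, O U -> O V ->
    exists W, [/\ O W, refines W U & refines W V]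
}.

Record replete O : Prop := Replete {
  replete_admissible : admissible O;
  replete_cover : forall x : X, \bigcup_(U in O) star [set x] U = setT;
  replete_directed : forall U V, O U -> O V ->
    exists W, [/\ O W, half_refines U W & half_refines V W]
}.

Definition adm_bounded O Y :=
  Y !=set0 /\
  exists2 U, O U & forall x y, Y x -> Y y -> star [set x] U y.

Definition bounded_net O (L : directedSet) (x : L -> X) :=
  adm_bounded O (range x).

Definition cauchy_net O (L : directedSet) (x : L -> X) :=
  forall U, O U -> exists l0 : L, forall l1 l2 : L,
    dle l0 l1 -> dle l0 l2 -> star [set x l1] U (x l2).

Definition complete_admissible O :=
  forall (L : directedSet) (x : L -> X), cauchy_net O x -> net_converges x.

End Coverings.

Definition filter_basis (S : Type) (F : set_system S) :=
  [/\ F !=set0, ~ F set0 &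
    forall A B, F A -> F B -> exists2 C, F C & C `<=` A `&` B].

Definition tends_to_infinity (S : Type) (F : set_system S)
    (L : directedSet) (t : L -> S) :=
  forall A, F A -> exists l0 : L, forall l : L, dle l0 l -> A (t l).

Definition is_action (S : semigroupType) (X : Type) (mu : S -> X -> X) :=
  forall s t x, mu s (mu t x) = mu (s * t)%g x.

Definition action_image (S X : Type) (mu : S -> X -> X) (A : set S) (Y : set X)
    : set X :=
  \bigcup_(s in A) (mu s @` Y).

Section Compactness.
Context {S : Type} {X : topologicalType}.
Variables (mu : S -> X -> X) (F : set_system S) (O : set (set (set X))).

Definition asymptotically_compact :=
  forall (L : directedSet) (x : L -> X) (t : L -> S),
    bounded_net O x -> tends_to_infinity F t ->
    has_convergent_subnet (fun l => mu (t l) (x l)).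

Definition limit_compact :=
  forall (B : set X) (U : set (set X)), adm_bounded O B -> O U ->
    exists2 A, F A & exists s : seq X,
      action_image mu A B `<=` \bigcup_(x in [set` s]) star [set x] U.

End Compactness.

(* Main.v *)
Require Import Defs.
From HB Require Import structures.
From mathcomp Require Import all_boot.
From mathcomp Require Import all_classical all_reals topology normedtype.

Set Implicit Arguments.
Unset Strict Implicit.
Unset Printing Implicit Defensive.

Local Open Scope classical_set_scope.

(** Forward, by contradiction: if no [A] in [F] gives a finite cover by stars, points of [A B] can
    avoid the stars of any finite set of centres. Indexed by [basis_seq_dset], they form a net that
    eventually leaves the star of every point; these stars are neighborhoods ([nbhs_star]), so no
    subnet converges. Conversely, an ultrafilter containing the tails picks one star from each
    finite cover ([ultra_bigcup_seq]). Points in one star of a half refinement are close to each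
    other ([star_half_refines]), so the subnet built from the ultrafilter ([filter_dset]) is Cauchy,
    and completeness gives a limit. *)

Lemma adm_bounded_subset (X : topologicalType) (O : set (set (set X)))
    (B Y : set X) :
  Y !=set0 -> Y `<=` B -> adm_bounded O B -> adm_bounded O Y.
Proof.
move=> Y0 YB [_ [U OU Ub]]; split=> //.
by exists U => // x y /YB Bx /YB; apply: Ub.
Qed.

Lemma nbhs_star (X : topologicalType) (U : set (set X)) (p : X) :
  open_covering U -> nbhs p (star [set p] U).
Proof.
move=> [opU covU]; have [A UA Ap] : cover U id p by rewrite covU.
apply: filterS (open_nbhs_nbhs (conj (opU A UA) Ap)) => x Ax.
by exists A => //; split=> //; exists p.
Qed.

(** The members of [V] holding [x] and [y] meet at [c], so one member of [U] contains both. The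
    centre drops out, as the Cauchy condition only compares points of the net. *)
Lemma star_half_refines (X : topologicalType) (U V : set (set X)) (c x y : X) :
  half_refines V U -> star [set c] V x -> star [set c] V y ->
  star [set x] U y.
Proof.
move=> VU [A [VA [_ [-> Ac]]] Ax] [A' [VA' [_ [-> Ac']]] Ay].
have [] := VU A A' VA VA'; first by exists c.
move=> B UB AB; exists B; last by apply: AB; right.
by split=> //; exists x; split=> //; apply: AB; left.
Qed.

Lemma tails_filter (L : directedSet) : ProperFilter (@tails L).
Proof.
have [l0] := dset_nonempty L.
apply: filter_from_proper; last by move=> l _; exists l; apply: dle_refl.
apply: filter_from_filter; first by exists l0.
move=> l1 l2 _ _; have [l3 [l13 l23]] := dset_directed l1 l2.
by exists l3 => // l l3l; split; [apply: dle_trans l3l|apply: dle_trans l3l].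
Qed.

(** Induction on [s]: if [P i] is not in [G], its complement is, and intersecting with it removes
    [P i] from the union. The empty union is excluded since [G] is proper. *)
Lemma ultra_bigcup_seq (T : Type) (I : choiceType) (G : set_system T)
    (s : seq I) (P : I -> set T) :
  UltraFilter G -> G (\bigcup_(i in [set` s]) P i) -> exists i, G (P i).
Proof.
move=> GU; rewrite bigcup_seq; elim: s => [|i s IHs].
  by rewrite big_nil => /filter_not_empty.
rewrite big_cons => Gis.
have [|GN] := in_ultra_setVsetC (P i) GU; first by exists i.
by apply: IHs; apply: filterS (filterI Gis GN) => t [[]].
Qed.

Section BasisSeqDirected.
Context {S : Type} {X : eqType} (F : set_system S) (basF : filter_basis F).

Let idx : Type := {A : set S | F A} * seq X.
(** Reverse inclusion on [F] makes nets chosen in the first component tend to infinity; growing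
    sequences eventually contain any given point. *)
Let le (i j : idx) := sval j.1 `<=` sval i.1 /\ {subset i.2 <= j.2}.

Let le_refl i : le i i. Proof. by split. Qed.

Let le_trans j i k : le i j -> le j k -> le i k.
Proof.
move=> [ji sij] [kj sjk]; split; first exact: subset_trans ji.
by move=> x /sij /sjk.
Qed.

Let idx_nonempty : inhabited idx.
Proof. by have [[A FA] _ _] := basF; split; exact: (exist _ A FA, [::]). Qed.

Let le_directed i j : exists k, le i k /\ le j k.
Proof.
case: i j => [[A FA] s] [[B FB] s']; have [_ _ FI] := basF.
have [C FC CAB] := FI _ _ FA FB; exists (exist _ C FC, s ++ s').
split; split=> /= [x /CAB[]//|x xs]; rewrite mem_cat xs ?orbT //.
Qed.

Definition basis_seq_dset : directedSet :=
  DirectedSet le_refl le_trans idx_nonempty le_directed.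

End BasisSeqDirected.

Section FilterSubnet.
Context {L : directedSet} (G : set_system L).
Hypotheses (GF : ProperFilter G) (tailsG : @tails L `<=` G).

(** Pointed members of [G], the usual passage from a filter to a net. The order also compares the
    points, so that the index map is monotone. *)
Let idx : Type := {gl : set L * L | G gl.1 /\ gl.1 gl.2}.
Let le (i j : idx) :=
  (sval j).1 `<=` (sval i).1 /\ dle (sval i).2 (sval j).2.

Let le_refl i : le i i. Proof. by split=> //; apply: dle_refl. Qed.

Let le_trans j i k : le i j -> le j k -> le i k.
Proof.
move=> [ji lij] [kj ljk]; split; first exact: subset_trans ji.
exact: dle_trans ljk.
Qed.

Let tailG (l : L) : G [set l' | dle l l'].
Proof. by apply: tailsG; exists l. Qed.

Let idx_nonempty : inhabited idx.
Proof.
have [l _] := filter_ex (filterT : G setT).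
by split; exact: (exist _ (setT, l) (conj filterT I)).
Qed.

Let le_directed i j : exists k, le i k /\ le j k.
Proof.
case: i j => [[g l] [/= Gg gl]] [[g' l'] [/= Gg' gl']].
have Ggg' : G (g `&` g') by exact: filterI.
have [j [lj l'j]] := dset_directed l l'.
(* Every tail lies in [G], so the tail of [j] meets the intersection of [g] and [g']. *)
have [k [[gk g'k] jk]] := filter_ex (filterI Ggg' (tailG j)).
exists (exist _ (g `&` g', k) (conj Ggg' (conj gk g'k))).
by split; split=> /=; [move=> x []|apply: dle_trans jk
                      |move=> x []|apply: dle_trans jk].
Qed.

Definition filter_dset : directedSet :=
  DirectedSet le_refl le_trans idx_nonempty le_directed.

Definition filter_dset_index (m : filter_dset) : L := (sval m).2.

Lemma filter_dset_subnet : is_subnet_map filter_dset_index.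
Proof.
split=> [m1 m2 []//|l].
have ll : [set l' | dle l l'] l by apply: dle_refl.
by exists (exist _ ([set l' | dle l l'], l) (conj (tailG l) ll)); apply: dle_refl.
Qed.

Lemma filter_dset_eventually (g : set L) : G g ->
  exists m0 : filter_dset, forall m, dle m0 m -> g (filter_dset_index m).
Proof.
move=> Gg; have [l gl] := filter_ex Gg.
exists (exist _ (g, l) (conj Gg gl)) => -[[g' l'] [/= Gg' gl']] [/= g'g _].
exact: g'g.
Qed.

End FilterSubnet.

(* If no [A] in [F] works for [B] and [U], choose for each [A] in [F] and each
   finite [s] a point of [A B] outside the [U]-stars of [s]. A limit [p] of a
   subnet would have [star [set p] U] as a neighborhood, which the net leaves
   once [p] is in [s]. *)
Lemma asymptotically_compact_limit_compact (S : Type) (X : topologicalType)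
    (mu : S -> X -> X) (F : set_system S) (O : set (set (set X))) :
  (forall U, O U -> open_covering U) -> filter_basis F ->
  asymptotically_compact mu F O -> limit_compact mu F O.
Proof.
move=> openO basF acF B U bB OU; apply: contrapT => nlc.
pose L := @basis_seq_dset S X F basF.
have esc (i : L) : exists sx : S * X, [/\ sval i.1 sx.1, B sx.2 &
    forall p, p \in i.2 -> ~ star [set p] U (mu sx.1 sx.2)].
  case: i => [[A FA] s] /=; apply: contrapT => Nsx; apply: nlc.
  exists A => //; exists s => _ [a Aa [x Bx <-]]; apply: contrapT => Nax.
  apply: Nsx; exists (a, x); split=> //= p ps pax.
  by apply: Nax; exists p.
have [tx txP] := choice esc.
have [l0] := dset_nonempty L.
have bx : bounded_net O (fun l : L => (tx l).2).
  apply: adm_bounded_subset bB; first by exists (tx l0).2, l0.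
  by move=> _ [l _ <-]; have [] := txP l.
have tF : tends_to_infinity F (fun l : L => (tx l).1).
  move=> A FA; exists ((exist _ A FA, [::]) : L) => l [lA _].
  by apply: lA; have [] := txP l.
have [M [h [[hmono hcof] [p yp]]]] := acF L _ _ bx tF.
have [m1 _ m1P] := yp _ (nbhs_star p (openO U OU)).
(* Only [[:: p]] matters here; [l0.1] is an arbitrary member of [F]. *)
have [m2 [_ m2P]] := hcof ((l0.1, [:: p]) : L).
have [m3 [m13 m23]] := dset_directed m1 m2.
have [_ _ /(_ p)] := txP (h m3); apply; last exact: (m1P m3).
have [_ m3P] := hmono _ _ m23.
by apply: m3P; apply: m2P; rewrite inE.
Qed.

(* An ultrafilter finer than the tails selects one star from each finite cover,
   so the subnet it defines is Cauchy. *)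
Lemma limit_compact_asymptotically_compact (S : Type) (X : topologicalType)
    (mu : S -> X -> X) (F : set_system S) (O : set (set (set X))) :
  (forall U, O U -> exists2 V, O V & half_refines V U) ->
  complete_admissible O -> limit_compact mu F O ->
  asymptotically_compact mu F O.
Proof.
move=> halfO complO lcF L x t bx tF; pose y l := mu (t l) (x l).
have [G [GU tailsG]] := ultraFilterLemma (tails_filter L).
have GF : ProperFilter G by exact: ultra_proper.
exists (filter_dset GF tailsG), (@filter_dset_index L G GF tailsG).
split; first exact: filter_dset_subnet.
apply: complO => U OU.
have [V OV VU] := halfO U OU.
(* The bounded set to which limit compactness is applied is the range of [x]. *)
have [A FA [s ABs]] := lcF _ V bx OV.
have [l0 l0P] := tF A FA.
have : G (\bigcup_(c in [set` s]) (y @^-1` star [set c] V)).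
  apply: tailsG; exists l0 => // l l0l; rewrite -preimage_bigcup.
  apply: ABs; exists (t l); first exact: l0P.
  by exists (x l) => //; exists l.
move=> /ultra_bigcup_seq[c Gc].
have [m0 m0P] := filter_dset_eventually GF tailsG Gc.
exists m0 => m1 m2 /m0P cm1 /m0P cm2.
exact: star_half_refines VU cm1 cm2.
Qed.

Theorem theorem2 (X : topologicalType) (O : set (set (set X)))
    (S : topologicalSemigroupType) (mu : S -> X -> X) (F : set_system S)
    (crX : completely_regular_space X) (repO : replete O)
    (actmu : is_action mu) (ctsmu : forall s : S, continuous (mu s))
    (basF : filter_basis F) :
  (asymptotically_compact mu F O -> limit_compact mu F O) /\
  (complete_admissible O -> limit_compact mu F O ->
   asymptotically_compact mu F O).
Proof.
have [admO _ _] := repO; split.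
  exact: asymptotically_compact_limit_compact (admissible_open admO) basF.
exact: limit_compact_asymptotically_compact (admissible_half admO).
Qed.
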